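(* Fix a time step $k$. Consider the distributed Kalman-filtering (DKF) problem of minimizing $\sum_{i=1}^N f_i(\xi_i)$ over $\xi=[\xi_1;\dots;\xi_N]\in\mathbb{R}^{Nn}$ subject to $\xi_1=\cdots=\xi_N$, where $$f_i(\xi_i)=\tfrac12(\bar z_{i,k}-\bar H_i\xi_i)^\top \bar S_{i,k}^{-1}(\bar z_{i,k}-\bar H_i\xi_i).$$ A solution of the DKF problem means a primal-dual pair $(\xi^*,\lambda^* )\in\mathbb{R}^{Nn}\times\mathbb{R}^{Nn}$ satisfying the saddle point (KKT) equation $$\begin{bmatrix} -\bar H^\top\bar S_k^{-1}\bar H & -\bar L\\ \bar L & 0\end{bmatrix}\begin{bmatrix}\xi^*\\ \lambda^*\end{bmatrix}=\begin{bmatrix}-\bar H^\top\bar S_k^{-1}\bar z_k\\ 0\end{bmatrix}.$$ Then: (1) The solutions to the DKF problem are parameterized as $$(\xi^*,\lambda^* )=\big((1_N\otimes I_n)\xi^\dagger,\ (1_N\otimes I_n)\tilde\lambda+\bar\lambda\big),$$ where $\xi^\dagger\in\mathbb{R}^n$ and $\bar\lambda\in\mathbb{R}^{Nn}$ are unique vectors and $\tilde\lambda\in\mathbb{R}^n$ is an arbitrary vector. (2) If $(\xi^*,\lambda^* )$, with $\xi^*=[\xi_1^*;\dots;\xi_N^*]$, is an optimal solution to the DKF problem, then $\xi_i^*$ (for each $i$) is the optimal solution $\hat x_k$ to the centralized Kalman-filtering (CKF) problem, i.e. $\xi_i^*=\hat x_k=\operatorname{argmin}_{\xi_c\in\mathbb{R}^n}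 f_c(\xi_c)$.
   Context: System. $x_{k+1}=Fx_k+w_k$, $y_k=Hx_k+v_k$, with $x_k\in\mathbb{R}^n$, and $N$ sensors. Here $y_k=[y_{1,k};\dots;y_{N,k}]\in\mathbb{R}^m$ with $y_{i,k}\in\mathbb{R}^{m_i}$, $\sum_i m_i=m$, and $H=[H_1;\dots;H_N]$ with $H_i\in\mathbb{R}^{m_i\times n}$. The semicolon notation $[A_1;\dots;A_N]$ denotes vertical stacking. The noises are $w_k\sim \mathsf{N}(0,Q)$ and $v_k=[v_{1,k};\dots;v_{N,k}]\sim\mathsf{N}(0,R)$ with $R=\mathrm{diag}(R_1,\dots,R_N)$ (block diagonal), $v_{i,k}\sim\mathsf{N}(0,R_i)$ uncorrelated with $v_{j,k}$ for $j\ne i$, each $R_i$ symmetric positive definite. The pair $(F,H)$ is observable. Predicted quantities. At the given step $k$, $\hat x_{k|k-1}\in\mathbb{R}^n$ is the predicted estimate and $P_{k|k-1}\in\mathbb{R}^{n\times n}$ is the predicted error covariance, symmetric positive definite. Each estimator $i$ holds local predictions $\hat x_{i,k|k-1}$ and $P_{i,k|k-1}$, and it is assumed that $\hat x_{i,k|k-1}=\hat x_{k|k-1}$ and $P_{i,k|k-1}=P_{k|k-1}$ for all $i$. The measurements $y_{i,k}$ are regarded as given vectors. CKF problem. With $z_k=[y_k;\hat x_{k|k-1}]$, $\bar H_c=[H;I_n]$, $S_k=\mathrm{diag}(R,P_{k|k-1})$, the CKF problem is to minimize $f_c(\xi_c)=\frac12(z_k-\bar H_c\xi_c)^\top S_k^{-1}(z_k-\bar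 H_c\xi_c)$ over $\xi_c\in\mathbb{R}^n$. Its minimizer is $\hat x_k=\hat x_{k|k-1}+K(y_k-H\hat x_{k|k-1})$ with $K=(H^\top R^{-1}H+P_{k|k-1}^{-1})^{-1}H^\top R^{-1}$. Local data. $\bar z_{i,k}=[y_{i,k};\hat x_{i,k|k-1}]$, $\bar H_i=[H_i;I_n]$, $\bar S_{i,k}=\mathrm{diag}(R_i,N P_{i,k|k-1})$; $\bar z_k=[\bar z_{1,k};\dots;\bar z_{N,k}]$, $\bar H=\mathrm{diag}(\bar H_1,\dots,\bar H_N)$, $\bar S_k=\mathrm{diag}(\bar S_{1,k},\dots,\bar S_{N,k})$. Network. The estimators communicate over an undirected connected graph on $N$ nodes with weights $a_{ij}=a_{ji}\ge 0$, $a_{ii}=0$ ($a_{ij}>0$ iff $i$ and $j$ are adjacent). $L\in\mathbb{R}^{N\times N}$ is its Laplacian: $l_{ij}=-a_{ij}$ for $i\ne j$, $l_{ii}=\sum_j a_{ij}$. $\bar L=L\otimes I_n$ ($\otimes$ is the Kronecker product, $I_n$ the $n\times n$ identity), and $1_N\in\mathbb{R}^N$ is the all-ones vector. The constraint $\xi_1=\dots=\xi_N$ is equivalent to $\bar L\xi=0$, the Lagrangian is $\sum_i f_i(\xi_i)+\lambda^\top\bar L\xi$ with dual variable $\lambda\in\mathbb{R}^{Nn}$, and the displayed saddle point equation is its optimality condition.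
   Formalization: Since λ̃ is arbitrary, λ̄ is determined only up to adding a vector (1_N⊗I_n)c, so its literal uniqueness fails for n>0; the formal theorem states uniqueness of (ξ†, λ̄) with λ̄ normalized to be orthogonal to the range of 1_N⊗I_n. *)

(* Defs.v *)
From mathcomp Require Import all_boot all_order all_algebra.
From mathcomp Require Import mxtens.

Set Implicit Arguments.
Unset Strict Implicit.
Unset Printing Implicit Defensive.

Import Order.TTheory GRing.Theory Num.Theory.
Local Open Scope ring_scope.

Definition sym_posdef (R : realFieldType) (n : nat) (A : 'M[R]_n) : Prop :=
  A^T = A /\ forall x : 'cV[R]_n, x != 0 -> 0 < (x^T *m A *m x) 0 0.

(* Full column rank of the stacked matrix [H; HF; ...; HF^(n-1)]. *)
Definition observable (R : realFieldType) (n p : nat)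
    (F : 'M[R]_n) (H : 'M[R]_(p, n)) : Prop :=
  \rank (\mxcol_(i < n) (H *m F ^+ i)) = n.

Definition diag2_mx (R : realFieldType) (p q : nat)
    (A : 'M[R]_p) (B : 'M[R]_q) : 'M[R]_(p + q) :=
  block_mx A 0 0 B.

(* Block diagonal matrix with rectangular p_i x n blocks; [\mxdiag] only
   covers square blocks. *)
Definition diag_rect_mx (R : realFieldType) (N n : nat) (p : 'I_N -> nat)
    (A : forall i, 'M[R]_(p i, n)) :
    'M[R]_(\sum_(i < N) p i, \sum_(j < N) n) :=
  \mxblock_(i < N, j < N) (if i == j then A i else 0).

(* The quadratic cost 1/2 (z - H xi)^T S^-1 (z - H xi). *)
Definition wls_cost (R : realFieldType) (p n : nat)
    (z : 'cV[R]_p) (H : 'M[R]_(p, n)) (S : 'M[R]_p) (xi : 'cV[R]_n) : R :=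
  2^-1 * ((z - H *m xi)^T *m invmx S *m (z - H *m xi)) 0 0.

Definition is_minimizer (R : realFieldType) (T : Type) (f : T -> R) (x : T)
    : Prop :=
  forall x', f x <= f x'.

Definition undirected_weights (R : realFieldType) (N : nat) (a : 'M[R]_N)
    : Prop :=
  [/\ forall i j, a i j = a j i, forall i j, 0 <= a i j
    & forall i, a i i = 0].

Definition connected_weights (R : realFieldType) (N : nat) (a : 'M[R]_N)
    : Prop :=
  forall i j, connect [rel i j | 0 < a i j] i j.

Definition laplacian (R : realFieldType) (N : nat) (a : 'M[R]_N) : 'M[R]_N :=
  \matrix_(i, j) (if i == j then \sum_k a i k else - a i j).

(* Vectors [xi_1; ...; xi_N] of R^(Nn) have length [\sum_(i < N) n], so that
   [\mxcol] builds them and [submxcol xi i] is the block xi_i. The Kronecker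
   product [*t] has dimensions of the form [N * n]; the casts below only
   identify these lengths (both orderings are by block, then within a block). *)
Lemma stack_dim (N n : nat) : (N * n = \sum_(i < N) n)%N.
Proof. by rewrite sum_nat_const card_ord. Qed.

(* L (x) I_n *)
Definition kron_id (R : realFieldType) (N n : nat) (L : 'M[R]_N) :
    'M[R]_(\sum_(i < N) n) :=
  castmx (stack_dim N n, stack_dim N n) (L *t (1%:M : 'M[R]_n)).

(* 1_N (x) I_n *)
Definition ones_kron (R : realFieldType) (N n : nat) :
    'M[R]_(\sum_(i < N) n, n) :=
  castmx (stack_dim N n, mul1n n)
    ((const_mx 1 : 'cV[R]_N) *t (1%:M : 'M[R]_n)).

Section LocalData.
Context (R : realFieldType) (N n : nat) (m : 'I_N -> nat).
Context (y : forall i, 'cV[R]_(m i)) (H : forall i, 'M[R]_(m i, n)).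
Context (Rv : forall i, 'M[R]_(m i)).

Definition loc_z (xloc : 'I_N -> 'cV[R]_n) (i : 'I_N) : 'cV[R]_(m i + n) :=
  col_mx (y i) (xloc i).

Definition loc_H (i : 'I_N) : 'M[R]_(m i + n, n) := col_mx (H i) 1%:M.

Definition loc_S (Ploc : 'I_N -> 'M[R]_n) (i : 'I_N) : 'M[R]_(m i + n) :=
  diag2_mx (Rv i) (N%:R *: Ploc i).

(* Saddle point equation of the Lagrangian
     \sum_i wls_cost (loc_z i) (loc_H i) (loc_S i) xi_i + lam^T Lbar xi
   of the consensus-constrained problem, Lbar = L (x) I_n. *)
Definition dkf_solution (a : 'M[R]_N)
    (xloc : 'I_N -> 'cV[R]_n) (Ploc : 'I_N -> 'M[R]_n)
    (xi lam : 'cV[R]_(\sum_(i < N) n)) : Prop :=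
  let zbar := \mxcol_(i < N) loc_z xloc i in
  let Hbar := diag_rect_mx loc_H in
  let Sbar := \mxdiag_(i < N) loc_S Ploc i in
  let Lbar := kron_id n (laplacian a) in
  block_mx (- (Hbar^T *m invmx Sbar *m Hbar)) (- Lbar) Lbar 0
    *m col_mx xi lam
  = col_mx (- (Hbar^T *m invmx Sbar *m zbar)) 0.

Definition ckf_cost (xpred : 'cV[R]_n) (P : 'M[R]_n) (xi : 'cV[R]_n) : R :=
  wls_cost (col_mx (\mxcol_(i < N) y i) xpred)
           (col_mx (\mxcol_(i < N) H i) 1%:M)
           (diag2_mx (\mxdiag_(i < N) Rv i) P) xi.

Definition ckf_estimate (xpred : 'cV[R]_n) (P : 'M[R]_n) : 'cV[R]_n :=
  let yk := \mxcol_(i < N) y i in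
  let Hk := \mxcol_(i < N) H i in
  let Rk := \mxdiag_(i < N) Rv i in
  let K := invmx (Hk^T *m invmx Rk *m Hk + invmx P) *m Hk^T *m invmx Rk in
  xpred + K *m (yk - Hk *m xpred).

End LocalData.

(* The pairs in [sol] are exactly
   ((1_N (x) I_n) xid, (1_N (x) I_n) lamt + lamb), lamt arbitrary. *)
Definition parameterizes (R : realFieldType) (N n : nat)
    (sol : 'cV[R]_(\sum_(i < N) n) -> 'cV[R]_(\sum_(i < N) n) -> Prop)
    (xid : 'cV[R]_n) (lamb : 'cV[R]_(\sum_(i < N) n)) : Prop :=
  forall xi lam,
    sol xi lam <->
    exists lamt : 'cV[R]_n,
      xi = ones_kron R N n *m xid /\ lam = ones_kron R N n *m lamt + lamb.

(* Main.v *)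
Require Import Defs.
From mathcomp Require Import all_boot all_order all_algebra.
From mathcomp Require Import mxtens.

Set Implicit Arguments.
Unset Strict Implicit.
Unset Printing Implicit Defensive.

Import Order.TTheory GRing.Theory Num.Theory.
Local Open Scope ring_scope.

(** Write [E = 1_N (x) I_n], [L] for the Kronecker Laplacian, and
    [A = Hbar^T Sbar^-1 Hbar], [b = Hbar^T Sbar^-1 zbar]. The saddle point
    equation says [A xi + L lam = b] and [L xi = 0].

    Since the graph is connected, the kernel of [L] is the range of [E]: the
    Dirichlet form [\sum a_ij (u_i - u_j)^2] of a kernel vector vanishes, so the
    vector is constant along edges ([laplacian_kernel]). Since [L] is symmetric,
    its range is the orthogonal of that kernel, i.e. the [w] with [E^T w = 0]
    ([kron_laplacian_solve]). Hence [xi = E xid], and applying [E^T] eliminates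
    [lam]: [(E^T A E) xid = E^T b]. When [E^T A E] is invertible this determines
    [xid]; conversely it is exactly the condition under which
    [L lam = b - A E xid] is solvable, with a solution unique modulo [E]
    ([saddle_parameterization]).

    The link with the centralized filter is that [E^T A E] and [E^T b] are the
    matrix and the right-hand side of the normal equation of the centralized
    cost: on the consensus subspace the [N] copies of the prior, each with
    covariance [N P], together carry the information [P^-1] of a single prior
    of covariance [P] ([stacked_form]). The gain formula solves that normal
    equation ([ckf_estimate_normal]), and the solution of a normal equation with
    positive definite matrix is the only minimizer of its least-squares cost
    ([wls_cost_minimizer]). The matrix is positive definite because the prior
    contributes an identity block to the observation matrix, which makes that
    matrix injective. *)

(** * Positive definite matrices *)

Lemma injective_unitmx (R : fieldType) (n : nat) (A : 'M[R]_n) :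
  (forall x : 'cV[R]_n, A *m x = 0 -> x = 0) -> A \in unitmx.
Proof.
move=> injA; rewrite -unitmx_tr -row_free_unit -kermx_eq0.
apply/eqP/row_matrixP => i; rewrite row0; apply: trmx_inj; rewrite trmx0.
apply: injA; apply: trmx_inj; rewrite trmx_mul trmxK trmx0.
by apply/sub_kermxP; rewrite row_sub.
Qed.

Lemma posdef_unitmx (R : realFieldType) (n : nat) (A : 'M[R]_n) :
  sym_posdef A -> A \in unitmx.
Proof.
case=> _ posA; apply: injective_unitmx => x Ax0; apply/eqP/negPn/negP => /posA.
by rewrite -mulmxA Ax0 mulmx0 mxE ltxx.
Qed.

Lemma posdef_ge0 (R : realFieldType) (n : nat) (A : 'M[R]_n) (x : 'cV[R]_n) :
  sym_posdef A -> 0 <= (x^T *m A *m x) 0 0.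
Proof.
case=> _ posA; have [->|nzx] := eqVneq x 0; first by rewrite mulmx0 mxE.
exact/ltW/posA.
Qed.

Lemma posdef_congr (R : realFieldType) (m n : nat) (W : 'M[R]_m)
    (H : 'M[R]_(m, n)) :
  sym_posdef W -> (forall x : 'cV[R]_n, H *m x = 0 -> x = 0) ->
  sym_posdef (H^T *m W *m H).
Proof.
move=> [symW posW] injH; split; first by rewrite !trmx_mul trmxK symW mulmxA.
move=> x nzx.
have -> : x^T *m (H^T *m W *m H) *m x = (H *m x)^T *m W *m (H *m x).
  by rewrite trmx_mul !mulmxA.
by apply: posW; apply: contra_neq nzx => /injH.
Qed.

(** The inverse of [A] is congruent to [A], since
    [A^-1 = (A^-1)^T A A^-1]. *)
Lemma posdef_invmx (R : realFieldType) (n : nat) (A : 'M[R]_n) :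
  sym_posdef A -> sym_posdef (invmx A).
Proof.
move=> pdA; have uA := posdef_unitmx pdA.
have -> : invmx A = (invmx A)^T *m A *m invmx A.
  by rewrite trmx_inv pdA.1 mulVmx // mul1mx.
apply: posdef_congr => // x /(congr1 (mulmx A)).
by rewrite mulKVmx // mulmx0.
Qed.

Lemma posdef_diag2_mx (R : realFieldType) (p q : nat)
    (A : 'M[R]_p) (B : 'M[R]_q) :
  sym_posdef A -> sym_posdef B -> sym_posdef (diag2_mx A B).
Proof.
move=> pdA pdB; split.
  by rewrite /diag2_mx tr_block_mx pdA.1 pdB.1 !trmx0.
move=> x; rewrite -[x]vsubmxK; set u := usubmx x; set v := dsubmx x => nzx.
rewrite /diag2_mx tr_col_mx mul_row_block !mulmx0 addr0 add0r mul_row_col mxE.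
have [u0|nzu] := eqVneq u 0; last by rewrite ltr_pwDl ?posdef_ge0 ?pdA.2.
rewrite ltr_wpDl ?posdef_ge0 // pdB.2 //; apply: contra_neq nzx => ->.
by rewrite u0 col_mx0.
Qed.

(** * Block diagonal weights *)

(** In a product weighted by a block diagonal matrix the sensors contribute
    independently; this is what lets local and central costs be compared. *)
Lemma mxcol_form (R : realFieldType) (N p q : nat) (m : 'I_N -> nat)
    (A : forall i, 'M[R]_(m i, p)) (W : forall i, 'M[R]_(m i))
    (B : forall i, 'M[R]_(m i, q)) :
  (\mxcol_i A i)^T *m (\mxdiag_i W i) *m (\mxcol_i B i)
  = \sum_i (A i)^T *m W i *m B i.
Proof. by rewrite tr_mxcol mul_mxrow_mxdiag mul_mxrow_mxcol. Qed.

Lemma posdef_mxdiag (R : realFieldType) (N : nat) (m : 'I_N -> nat)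
    (W : forall i, 'M[R]_(m i)) :
  (forall i, sym_posdef (W i)) -> sym_posdef (\mxdiag_i W i).
Proof.
move=> pdW; split.
  by rewrite tr_mxdiag; apply/eq_mxdiag => i; case: (pdW i).
move=> x nzx; rewrite -[x]submxcolK mxcol_form summxE.
have pos i : true -> 0 <= ((submxcol x i)^T *m W i *m submxcol x i) 0 0.
  by rewrite posdef_ge0.
rewrite lt_neqAle sumr_ge0 // andbT eq_sym psumr_eq0 //.
apply: contra_neqN nzx => /allP x0; apply/mxcolP => i; rewrite submxcol0.
have := x0 i (mem_index_enum i); apply: contraTeq => nz.
by rewrite gt_eqF // (pdW i).2.
Qed.

Lemma mxdiag_mul_invmx (R : realFieldType) (N : nat) (m : 'I_N -> nat)
    (W : forall i, 'M[R]_(m i)) :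
  (forall i, W i \in unitmx) ->
  (\mxdiag_i W i) *m (\mxdiag_i invmx (W i)) = 1%:M.
Proof.
move=> uW; rewrite mul_mxdiag_mxblock -mxdiagZ; apply/eq_mxblock => i j.
case: eqVneq => [<-|_]; last by rewrite mulmx0.
by rewrite !conform_mx_id mulmxV.
Qed.

Lemma mxdiag_unitmx (R : realFieldType) (N : nat) (m : 'I_N -> nat)
    (W : forall i, 'M[R]_(m i)) :
  (forall i, W i \in unitmx) -> \mxdiag_i W i \in unitmx.
Proof. by move/mxdiag_mul_invmx/mulmx1_unit => []. Qed.

Lemma invmx_mxdiag (R : realFieldType) (N : nat) (m : 'I_N -> nat)
    (W : forall i, 'M[R]_(m i)) :
  (forall i, W i \in unitmx) -> invmx (\mxdiag_i W i) = \mxdiag_i invmx (W i).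
Proof.
move=> uW; rewrite -[RHS](mulKmx (mxdiag_unitmx uW)).
by rewrite mxdiag_mul_invmx ?mulmx1.
Qed.

(** * Weighted least squares *)

(** Completing the square: by the normal equation the residual [r] at [xh] is
    [S^-1]-orthogonal to the range of [H], so that the cost at [u] exceeds the
    cost at [xh] by half the quadratic form of [H^T S^-1 H] at [u - xh]. *)
Lemma wls_cost_minimizer (R : realFieldType) (p n : nat) (z : 'cV[R]_p)
    (H : 'M[R]_(p, n)) (S : 'M[R]_p) (xh x : 'cV[R]_n) :
  sym_posdef S -> (forall u : 'cV[R]_n, H *m u = 0 -> u = 0) ->
  H^T *m invmx S *m H *m xh = H^T *m invmx S *m z ->
  is_minimizer (wls_cost z H S) x <-> x = xh.
Proof.
move=> pdS injH normal_eq; have pdW := posdef_invmx pdS.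
have [_ posG] := posdef_congr pdW injH.
set W := invmx S in pdW normal_eq posG *.
pose r := z - H *m xh.
have HWr : H^T *m W *m r = 0 by rewrite mulmxBr mulmxA normal_eq subrr.
have rWH : r^T *m W *m H = 0.
  by apply: trmx_inj; rewrite !trmx_mul trmxK pdW.1 mulmxA HWr trmx0.
have costE u : wls_cost z H S u = wls_cost z H S xh
    + 2^-1 * ((u - xh)^T *m (H^T *m W *m H) *m (u - xh)) 0 0.
  rewrite /wls_cost -/W -/r -mulrDr; congr (_ * _).
  have -> : z - H *m u = r - H *m (u - xh).
    by rewrite /r mulmxBr opprB addrA subrK.
  move: (u - xh) => d; clearbody r.
  rewrite [(r - _)^T]linearB /= trmx_mul 2!mulmxBl !mulmxBr !mulmxA.
  rewrite rWH mul0mx subr0.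
  by rewrite -!(mulmxA d^T) HWr mulmx0 sub0r opprK !mulmxA mxE.
split=> [|-> u]; last first.
  rewrite (costE u) lerDl mulr_ge0 ?invr_ge0 ?ler0n //.
  exact/posdef_ge0/posdef_congr.
move/(_ xh); rewrite (costE x) gerDl; apply: contraTeq; rewrite -subr_eq0 => nz.
by rewrite -ltNge mulr_gt0 ?invr_gt0 ?ltr0n ?posG.
Qed.

(** * Kronecker products with the identity as block matrices *)

(** The block layout and the Kronecker layout enumerate the entries in the same
    order: the blocks that precede block [i] hold [i * n] entries. *)
Lemma stack_index (N n : nat) (i : 'I_N) (c : 'I_n) :
  cast_ord (esym (stack_dim N n)) (tagnat.Rank i c) = mxtens_index (i, c).
Proof.
apply: val_inj; transitivity (tagnat.Rank i c : nat) => //.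
rewrite tagnat.RankEsum.
by rewrite (big_ord_narrow (ltnW (ltn_ord i))) sum_nat_const card_ord.
Qed.

Lemma kron_idE (R : realFieldType) (N n : nat) (A : 'M[R]_N) :
  kron_id n A = \mxblock_(i < N, j < N) ((A i j)%:M : 'M[R]_n).
Proof.
apply/mxblockP => i j; rewrite mxblockK; apply/matrixP => c d.
by rewrite mxE castmxE !stack_index tensmxE !mxE mulr_natr.
Qed.

Lemma ones_kronE (R : realFieldType) (N n : nat) :
  ones_kron R N n = \mxcol_(i < N) (1%:M : 'M[R]_n).
Proof.
apply/mxcolP => i; rewrite mxcolK; apply/matrixP => c d.
rewrite mxE castmxE stack_index /=.
have -> : cast_ord (esym (mul1n n)) d = mxtens_index (ord0, d).
  by apply: val_inj; rewrite /= mul0n.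
by rewrite tensmxE !mxE mul1r.
Qed.

Lemma submxcol_kron_id (R : realFieldType) (N n p : nat) (A : 'M[R]_N)
    (v : 'M[R]_(\sum_(i < N) n, p)) (i : 'I_N) :
  submxcol (kron_id n A *m v) i = \sum_j A i j *: submxcol v j.
Proof.
rewrite -{1}[v]submxcolK kron_idE mul_mxblock_mxrow mxcolK.
by apply: eq_bigr => j _; rewrite mul_scalar_mx.
Qed.

Lemma submxcol_ones_kron (R : realFieldType) (N n p : nat) (x : 'M[R]_(n, p))
    (i : 'I_N) :
  submxcol (ones_kron R N n *m x) i = x.
Proof. by rewrite -submxcol_mul ones_kronE mxcolK mul1mx. Qed.

Lemma tr_kron_id (R : realFieldType) (N n : nat) (A : 'M[R]_N) :
  (kron_id n A)^T = kron_id n A^T.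
Proof.
rewrite !kron_idE tr_mxblock; apply/eq_mxblock => i j.
by rewrite tr_scalar_mx mxE.
Qed.

Lemma ones_kron_gram (R : realFieldType) (N n : nat) :
  (ones_kron R N n)^T *m ones_kron R N n = N%:R%:M.
Proof.
rewrite ones_kronE tr_mxcol mul_mxrow_mxcol.
under eq_bigr do rewrite trmx1 mul1mx.
by rewrite sumr_const card_ord -raddfMn.
Qed.

(** * The Laplacian of a connected graph *)

Lemma laplacian_sym (R : realFieldType) (N : nat) (a : 'M[R]_N) :
  undirected_weights a -> (laplacian a)^T = laplacian a.
Proof.
case=> syma _ _; apply/matrixP => i j; rewrite !mxE eq_sym.
by case: eqVneq => [->|_] //; rewrite syma.
Qed.

Lemma laplacian_mulE (R : realFieldType) (N : nat) (a : 'M[R]_N)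
    (u : 'cV[R]_N) (i : 'I_N) :
  undirected_weights a ->
  (laplacian a *m u) i 0 = \sum_j a i j * (u i 0 - u j 0).
Proof.
case=> _ _ diag0; rewrite mxE (bigD1 i) //= [RHS](bigD1 i) //=.
rewrite subrr mulr0 add0r mxE eqxx mulr_suml (bigD1 i) //= diag0.
rewrite mul0r add0r -big_split /=.
by apply: eq_bigr => j ji; rewrite mxE eq_sym (negPf ji) mulrBr mulNr.
Qed.

(** Pairing [u] with [L u] gives half the Dirichlet form
    [\sum_i \sum_j a_ij (u_i - u_j)^2], a sum of nonnegative terms. If
    [L u = 0] every term is zero, so [u] agrees along each edge, and hence along
    each path. *)
Lemma laplacian_kernel (R : realFieldType) (N : nat) (a : 'M[R]_N)
    (u : 'cV[R]_N) :
  undirected_weights a -> connected_weights a ->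
  laplacian a *m u = 0 -> forall i j, u i 0 = u j 0.
Proof.
move=> wa conn Lu0; have [syma posa _] := wa.
have Ediag : \sum_i \sum_j a i j * (u i 0 - u j 0) ^+ 2 = 0.
  (* Exchanging i and j in one of two copies of S = u^T L u turns their sum
     into the Dirichlet form. *)
  pose S := \sum_i \sum_j a i j * (u i 0 - u j 0) * u i 0.
  have S0 : S = 0.
    rewrite /S big1 // => i _; rewrite -mulr_suml.
    by rewrite -laplacian_mulE // Lu0 mxE mul0r.
  transitivity (S + S); last by rewrite S0 addr0.
  rewrite {2}/S [X in _ = _ + X]exchange_big -big_split.
  apply: eq_bigr => i _ /=.
  rewrite -big_split; apply: eq_bigr => j _ /=.
  rewrite (syma j i) -(opprB (u i 0) (u j 0)) mulrN mulNr -mulrBr.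
  by rewrite expr2 mulrA.
have edge i j : 0 < a i j -> u i 0 = u j 0.
  move=> aij; have nn k l : 0 <= a k l * (u k 0 - u l 0) ^+ 2.
    by rewrite mulr_ge0 ?sqr_ge0.
  have rowi : \sum_l a i l * (u i 0 - u l 0) ^+ 2 = 0.
    by apply: (psumr_eq0P _ Ediag) => // k _; exact: sumr_ge0.
  have /eqP : a i j * (u i 0 - u j 0) ^+ 2 = 0 by apply: (psumr_eq0P _ rowi).
  by rewrite mulf_eq0 (gt_eqF aij) sqrf_eq0 subr_eq0 => /eqP.
move=> i j; have /connectP[p] := conn i j.
elim: p i => [|k p IHp] i /= => [_ ->//|/andP[/edge -> pathp] lastp].
exact: IHp pathp lastp.
Qed.

Lemma kron_laplacian_ones (R : realFieldType) (N n : nat) (a : 'M[R]_N) :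
  undirected_weights a -> kron_id n (laplacian a) *m ones_kron R N n = 0.
Proof.
move=> wa; apply/mxcolP => i; rewrite submxcol0 submxcol_kron_id.
under eq_bigr do rewrite ones_kronE mxcolK.
rewrite -scaler_suml; have -> : \sum_j laplacian a i j = 0; last exact: scale0r.
transitivity ((laplacian a *m const_mx 1 : 'cV[R]_N) i 0).
  by rewrite mxE; apply: eq_bigr => j _; rewrite [const_mx _ _ _]mxE mulr1.
by rewrite laplacian_mulE // big1 // => j _; rewrite !mxE subrr mulr0.
Qed.

Lemma ones_kron_laplacian (R : realFieldType) (N n : nat) (a : 'M[R]_N) :
  undirected_weights a -> (ones_kron R N n)^T *m kron_id n (laplacian a) = 0.
Proof.
move=> wa; apply: trmx_inj; rewrite trmx_mul trmxK tr_kron_id laplacian_sym //.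
by rewrite kron_laplacian_ones ?trmx0.
Qed.

Lemma kron_laplacian_kernel (R : realFieldType) (N n : nat) (a : 'M[R]_N)
    (v : 'cV[R]_(\sum_(i < N) n)) (i : 'I_N) :
  undirected_weights a -> connected_weights a ->
  kron_id n (laplacian a) *m v = 0 -> v = ones_kron R N n *m submxcol v i.
Proof.
move=> wa conn Lv0; apply/mxcolP => j; rewrite submxcol_ones_kron.
apply/colP => c; pose u := \col_k submxcol v k c 0.
have Lu0 : laplacian a *m u = 0.
  apply/colP => k.
  transitivity ((\sum_l laplacian a k l *: submxcol v l) c 0).
    by rewrite summxE mxE; apply: eq_bigr => l _; rewrite [u _ _]mxE [RHS]mxE.
  by rewrite -submxcol_kron_id Lv0 submxcol0 !mxE.
by have := laplacian_kernel wa conn Lu0 j i; rewrite !mxE.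
Qed.

(** [L] is singular, but [L + E E^T] is invertible: applying [E^T] to
    [(L + E E^T) v] leaves [N E^T v], so a kernel vector [v] satisfies both
    [E^T v = 0] and [L v = 0], and the latter makes [v] a consensus vector. When
    [E^T w = 0], the same computation shows that the preimage of [w] by
    [L + E E^T] is orthogonal to [E], hence a preimage by [L]. *)
Lemma kron_laplacian_solve (R : realFieldType) (N n : nat) (a : 'M[R]_N)
    (w : 'cV[R]_(\sum_(i < N) n)) :
  (0 < N)%N -> undirected_weights a -> connected_weights a ->
  (ones_kron R N n)^T *m w = 0 ->
  exists v, (ones_kron R N n)^T *m v = 0 /\ kron_id n (laplacian a) *m v = w.
Proof.
move=> N0 wa conn Ew0; set E := ones_kron R N n in Ew0 *.
set L := kron_id n (laplacian a).
have EL : E^T *m L = 0 by exact: ones_kron_laplacian.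
have nzN : N%:R != 0 :> R by rewrite pnatr_eq0 -lt0n.
have EE0 k (x : 'M[R]_(n, k)) : E^T *m (E *m x) = 0 -> x = 0.
  move/eqP; rewrite mulmxA ones_kron_gram mul_scalar_mx scaler_eq0 (negPf nzN).
  by move/eqP.
have grounded v : E^T *m ((L + E *m E^T) *m v) = 0 -> E^T *m v = 0.
  by rewrite mulmxA mulmxDr EL add0r -!mulmxA => /EE0.
have uLE : L + E *m E^T \in unitmx.
  apply: injective_unitmx => v LEv0.
  have Ev0 : E^T *m v = 0 by apply: grounded; rewrite LEv0 mulmx0.
  have Lv0 : L *m v = 0.
    by rewrite -LEv0 mulmxDl -mulmxA Ev0 mulmx0 addr0.
  have vE := kron_laplacian_kernel (Ordinal N0) wa conn Lv0.
  by rewrite vE in Ev0 *; rewrite (EE0 _ _ Ev0) mulmx0.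
pose v := invmx (L + E *m E^T) *m w.
have LEv : (L + E *m E^T) *m v = w by rewrite mulKVmx.
have Ev0 : E^T *m v = 0 by apply: grounded; rewrite LEv.
by exists v; split=> //; rewrite -LEv mulmxDl -mulmxA Ev0 mulmx0 addr0.
Qed.

(** * Saddle point equations with a consensus constraint *)

(** The constraint forces [xi = E x], and left multiplication by [E^T] kills
    the multiplier term, which leaves for [x] the normal equation compressed to
    the consensus subspace. That equation is also the solvability condition for
    the multiplier, whose solutions differ by the kernel of [L]. *)
Lemma saddle_parameterization (R : realFieldType) (N n : nat) (a : 'M[R]_N)
    (A : 'M[R]_(\sum_(i < N) n)) (b : 'cV[R]_(\sum_(i < N) n))
    (xid : 'cV[R]_n) :
  (0 < N)%N -> undirected_weights a -> connected_weights a ->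
  let E := ones_kron R N n in let L := kron_id n (laplacian a) in
  E^T *m A *m E \in unitmx -> E^T *m A *m E *m xid = E^T *m b ->
  exists lamb, E^T *m lamb = 0 /\
    parameterizes (fun xi lam => A *m xi + L *m lam = b /\ L *m xi = 0)
      xid lamb.
Proof.
move=> N0 wa conn E L uG normal_eq.
have EL : E^T *m L = 0 by exact: ones_kron_laplacian.
have LE : L *m E = 0 by exact: kron_laplacian_ones.
have [lamb [Elamb Llamb]] : exists lamb, E^T *m lamb = 0 /\
    L *m lamb = b - A *m (E *m xid).
  by apply: kron_laplacian_solve => //; rewrite mulmxBr !mulmxA normal_eq subrr.
exists lamb; split=> // xi lam.
split=> [[stat Lxi0]|[lamt [-> ->]]]; last first.
  rewrite mulmxDr Llamb !mulmxA LE !mul0mx add0r -mulmxA.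
  by rewrite [A *m _ + _]addrC subrK.
pose i0 := Ordinal N0.
have xiE : xi = E *m submxcol xi i0.
  exact: (kron_laplacian_kernel i0 wa conn Lxi0).
have xi0E : submxcol xi i0 = xid.
  apply: (can_inj (mulKmx uG)); rewrite normal_eq -stat mulmxDr !mulmxA EL.
  by rewrite mul0mx addr0 -!mulmxA -xiE.
have lamE : lam - lamb = E *m submxcol (lam - lamb) i0.
  apply: (kron_laplacian_kernel i0 wa conn).
  rewrite -/L mulmxBr Llamb -xi0E -xiE -stat.
  by rewrite [A *m _ + _]addrC addrK subrr.
exists (submxcol (lam - lamb) i0); rewrite -lamE subrK; split=> //.
by rewrite xiE xi0E.
Qed.

(** Orthogonality to the range of [E] picks one point of the affine family of
    multipliers: two of them differ by some [E lamt], and [E^T E lamt = 0] gives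
    [lamt = 0]. *)
Lemma parameterizes_unique (R : realFieldType) (N n : nat)
    (sol : 'cV[R]_(\sum_(i < N) n) -> 'cV[R]_(\sum_(i < N) n) -> Prop)
    (xid xid' : 'cV[R]_n) (lamb lamb' : 'cV[R]_(\sum_(i < N) n)) :
  (0 < N)%N -> (ones_kron R N n)^T *m lamb = 0 ->
  (ones_kron R N n)^T *m lamb' = 0 ->
  parameterizes sol xid lamb -> parameterizes sol xid' lamb' ->
  xid = xid' /\ lamb = lamb'.
Proof.
move=> N0 Elamb Elamb' par par'; set E := ones_kron R N n in Elamb Elamb'.
have : sol (E *m xid) lamb.
  by apply/par; exists 0; rewrite mulmx0 add0r.
case/par' => lamt [xidE lambE]; split.
  by rewrite -(submxcol_ones_kron xid (Ordinal N0)) xidE submxcol_ones_kron.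
have lamt0 : lamt = 0.
  apply/eqP; have /eqP := Elamb; rewrite lambE mulmxDr Elamb' addr0 mulmxA.
  rewrite ones_kron_gram mul_scalar_mx scaler_eq0 pnatr_eq0.
  by rewrite -[_ == 0%N]negbK -lt0n N0.
by rewrite lambE lamt0 mulmx0 add0r.
Qed.

(** * Comparison with the centralized normal equation *)

Lemma diag_rect_mx_ones (R : realFieldType) (N n : nat) (p : 'I_N -> nat)
    (A : forall i, 'M[R]_(p i, n)) :
  diag_rect_mx A *m ones_kron R N n = \mxcol_i A i.
Proof.
rewrite ones_kronE mul_mxblock_mxrow; apply/eq_mxcol => i.
rewrite (bigD1 i) //= eqxx mulmx1 big1 ?addr0 // => j ji.
by rewrite eq_sym (negPf ji) mul0mx.
Qed.

(** The local priors add up to the central one, as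
    [N (N P)^-1 = P^-1]; the measurement terms agree sensor by sensor. With
    [B := H], [C := 1] this compares the matrices of the two normal equations,
    and with [B := y], [C := xpred] their right-hand sides. *)
Lemma stacked_form (R : realFieldType) (N n k : nat) (m : 'I_N -> nat)
    (H : forall i, 'M[R]_(m i, n)) (B : forall i, 'M[R]_(m i, k))
    (C : 'M[R]_(n, k)) (Rv : forall i, 'M[R]_(m i)) (P : 'M[R]_n) :
  (0 < N)%N -> (forall i, Rv i \in unitmx) -> P \in unitmx ->
  (\mxcol_i col_mx (H i) 1%:M)^T
    *m invmx (\mxdiag_i diag2_mx (Rv i) (N%:R *: P))
    *m (\mxcol_i col_mx (B i) C)
  = (col_mx (\mxcol_i H i) 1%:M)^T *m invmx (diag2_mx (\mxdiag_i Rv i) P)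
    *m col_mx (\mxcol_i B i) C.
Proof.
move=> N0 uR uP.
have nzN : N%:R != 0 :> R by rewrite pnatr_eq0 -lt0n.
have uNP : N%:R *: P \in unitmx by rewrite unitmxZ ?unitfE.
have uRs := mxdiag_unitmx uR.
rewrite invmx_mxdiag => [|i]; last by rewrite block_diag_mx_unit uR.
rewrite mxcol_form /diag2_mx invmx_block_diag ?block_diag_mx_unit ?uRs //.
have formE p (Hp : 'M[R]_(p, n)) (W : 'M[R]_p) V (Bp : 'M[R]_(p, k)) :
    (col_mx Hp 1%:M)^T *m block_mx W 0 0 V *m col_mx Bp C
    = Hp^T *m W *m Bp + V *m C.
  rewrite tr_col_mx trmx1 mul_row_block !mulmx0 addr0 add0r mul1mx.
  by rewrite mul_row_col.
rewrite formE invmx_mxdiag // mxcol_form.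
under eq_bigr => i _ do
  rewrite invmx_block_diag ?block_diag_mx_unit ?uR ?uNP // formE invmxZ //.
rewrite big_split /=; congr (_ + _).
rewrite sumr_const card_ord -scalemxAl -scaler_nat scalerA mulfV //.
by rewrite scale1r.
Qed.

Lemma saddle_blocksE (R : realFieldType) (p : nat) (A L : 'M[R]_p)
    (b xi lam : 'cV[R]_p) :
  block_mx (- A) (- L) L 0 *m col_mx xi lam = col_mx (- b) 0
  <-> A *m xi + L *m lam = b /\ L *m xi = 0.
Proof.
rewrite mul_block_col mul0mx addr0 !mulNmx -opprD.
by split=> [/eq_col_mx[/oppr_inj]|[-> ->]].
Qed.

(** With [V] the inverse of the measurement covariance, both sides equal
    [H^T V y + P^-1 xpred]: multiplying by
    [G = H^T V H + P^-1] cancels the [G^-1] of the gain, and the term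
    [- H^T V H xpred] of the innovation cancels the [H^T V H xpred] of
    [G xpred]. *)
Lemma ckf_estimate_normal (R : realFieldType) (N n : nat) (m : 'I_N -> nat)
    (y : forall i, 'cV[R]_(m i)) (H : forall i, 'M[R]_(m i, n))
    (Rv : forall i, 'M[R]_(m i)) (xpred : 'cV[R]_n) (P : 'M[R]_n) :
  let Hc := col_mx (\mxcol_i H i) 1%:M in
  let W := invmx (diag2_mx (\mxdiag_i Rv i) P) in
  \mxdiag_i Rv i \in unitmx -> P \in unitmx -> Hc^T *m W *m Hc \in unitmx ->
  Hc^T *m W *m Hc *m ckf_estimate y H Rv xpred P
  = Hc^T *m W *m col_mx (\mxcol_i y i) xpred.
Proof.
move=> Hc W uR uP.
rewrite /ckf_estimate; set Hk := \mxcol_i H i in Hc *; set yk := \mxcol_i y i.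
set V := invmx (\mxdiag_i Rv i).
have HcW : Hc^T *m W = row_mx (Hk^T *m V) (invmx P).
  rewrite /W /diag2_mx invmx_block_diag ?block_diag_mx_unit ?uR //.
  by rewrite tr_col_mx trmx1 mul_row_block !mulmx0 addr0 add0r mul1mx.
rewrite HcW !mul_row_col mulmx1; set G := Hk^T *m V *m Hk + invmx P => uG.
rewrite mulmxDr -!(mulmxA (invmx G)) mulKVmx // mulmxDl mulmxBr !mulmxA.
by rewrite addrC addrA subrK.
Qed.

(* Since lamt is arbitrary, lamb can only be unique modulo the range of
   1_N (x) I_n; it is normalized to be orthogonal to that range. *)
Theorem lemma1 (R : realFieldType) (N n : nat) (m : 'I_N -> nat)
    (F : 'M[R]_n) (H : forall i, 'M[R]_(m i, n))
    (Rv : forall i, 'M[R]_(m i)) (a : 'M[R]_N)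
    (y : forall i, 'cV[R]_(m i))
    (xpred : 'cV[R]_n) (P : 'M[R]_n)
    (xloc : 'I_N -> 'cV[R]_n) (Ploc : 'I_N -> 'M[R]_n)
    (hN : (0 < N)%N)
    (hobs : observable F (\mxcol_(i < N) H i))
    (hRv : forall i, sym_posdef (Rv i))
    (hP : sym_posdef P)
    (hxloc : forall i, xloc i = xpred)
    (hPloc : forall i, Ploc i = P)
    (ha : undirected_weights a)
    (hconn : connected_weights a) :
  (exists! p : 'cV[R]_n * 'cV[R]_(\sum_(i < N) n),
      (ones_kron R N n)^T *m p.2 = 0 /\
      parameterizes (dkf_solution y H Rv a xloc Ploc) p.1 p.2)
  /\
  (forall xi lam : 'cV[R]_(\sum_(i < N) n),
      dkf_solution y H Rv a xloc Ploc xi lam ->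
      forall i : 'I_N,
        submxcol xi i = ckf_estimate y H Rv xpred P /\
        (forall x : 'cV[R]_n,
            is_minimizer (ckf_cost y H Rv xpred P) x <-> x = submxcol xi i)).
Proof.

have uRv i := posdef_unitmx (hRv i); have uP := posdef_unitmx hP.
have uR := mxdiag_unitmx uRv.
set Hc := col_mx (\mxcol_i H i) 1%:M.
set Sc := diag2_mx (\mxdiag_i Rv i) P.
set zc := col_mx (\mxcol_i y i) xpred.
have pdSc : sym_posdef Sc by apply: posdef_diag2_mx => //; apply: posdef_mxdiag.
have injHc (u : 'cV[R]_n) : Hc *m u = 0 -> u = 0.
  by rewrite mul_col_mx mul1mx -col_mx0 => /eq_col_mx[].
have uG := posdef_unitmx (posdef_congr (posdef_invmx pdSc) injHc).
have normal_eq := ckf_estimate_normal y xpred uR uP uG.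
rewrite -/Sc -/Hc -/zc in normal_eq.
have Hbar_ones := diag_rect_mx_ones (loc_H H).
have zbarE : \mxcol_i loc_z y xloc i = \mxcol_i col_mx (y i) xpred.
  by apply: eq_mxcol => i; rewrite /loc_z hxloc.
have SbarE : \mxdiag_i loc_S Rv Ploc i = \mxdiag_i diag2_mx (Rv i) (N%:R *: P).
  by apply: eq_mxdiag => i; rewrite /loc_S hPloc.
set E := ones_kron R N n in Hbar_ones *.
pose Hbar := diag_rect_mx (loc_H H).
pose W := invmx (\mxdiag_i loc_S Rv Ploc i).
pose A := Hbar^T *m W *m Hbar; pose b := Hbar^T *m W *m \mxcol_i loc_z y xloc i.
(* On consensus vectors Hbar acts as the stack of the local observation
   matrices, so E^T A E and E^T b are stacked forms. *)
have GE : E^T *m A *m E = Hc^T *m invmx Sc *m Hc.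
  rewrite /A !mulmxA -trmx_mul -!mulmxA Hbar_ones !mulmxA /W SbarE.
  exact: stacked_form.
have gE : E^T *m b = Hc^T *m invmx Sc *m zc.
  rewrite /b !mulmxA -trmx_mul Hbar_ones /W SbarE zbarE.
  exact: stacked_form.
have dkfE xi lam : dkf_solution y H Rv a xloc Ploc xi lam <->
    A *m xi + kron_id n (laplacian a) *m lam = b
    /\ kron_id n (laplacian a) *m xi = 0 by exact: saddle_blocksE.
have [lamb [Elamb par]] : exists lamb, E^T *m lamb = 0 /\
    parameterizes (dkf_solution y H Rv a xloc Ploc)
      (ckf_estimate y H Rv xpred P) lamb.
  have [||lamb [Elamb par]] := @saddle_parameterization R N n a A b
    (ckf_estimate y H Rv xpred P) hN ha hconn.
  - by rewrite GE.
  - by rewrite GE gE.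
  by exists lamb; split=> // xi lam; split=> [/dkfE/par|/par/dkfE].
split.
  exists (ckf_estimate y H Rv xpred P, lamb); split=> // -[xid lamb'] /=.
  case=> Elamb' par'.
  by have [-> ->] := parameterizes_unique hN Elamb Elamb' par par'.
move=> xi lam /par[_ [-> _]] i; rewrite submxcol_ones_kron; split=> // x.
exact: wls_cost_minimizer.
Qed.
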